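(* Let $f:\mathbb{R}^n\to\mathbb{R}^n$ be locally Lipschitz and consider the dynamical system $\dot x=f(x)$. Let $h:\mathbb{R}^n\to\mathbb{R}$ be continuously differentiable and let $\mathcal{C}\subset\mathbb{R}^n$ be a set such that $$\mathcal{C}=\{x\in\mathbb{R}^n: h(x)\ge 0\},\quad \partial\mathcal{C}=\{x\in\mathbb{R}^n: h(x)=0\},\quad \mathrm{Int}(\mathcal{C})=\{x\in\mathbb{R}^n: h(x)>0\}.$$ If there exists a reciprocal barrier function $B:\mathrm{Int}(\mathcal{C})\to\mathbb{R}$ for $\mathcal{C}$ and this system, then $\mathrm{Int}(\mathcal{C})$ is forward invariant with respect to $\dot x=f(x)$.
   Context: $\mathrm{Int}(\mathcal{C})$ and $\partial\mathcal{C}$ denote the interior and boundary of $\mathcal{C}$. A continuous function $\beta:[0,a)\to[0,\infty)$, for some $a>0$ (possibly $a=\infty$), is of class $\mathcal{K}$ if it is strictly increasing and $\beta(0)=0$. Whenever an expression $\beta(s)$ is written, $s$ is understood to lie in the domain of $\beta$. $L_fB(x)=\frac{\partial B}{\partial x}(x)f(x)$ is the Lie derivative. Reciprocal barrier function (RBF): a continuously differentiable function $B:\mathrm{Int}(\mathcal{C})\to\mathbb{R}$ for which there exist class $\mathcal{K}$ functions $\alpha_1,\alpha_2,\alpha_3$ such that for all $x\in\mathrm{Int}(\mathcal{C})$, $$\frac{1}{\alpha_1(h(x))}\le B(x)\le\frac{1}{\alpha_2(h(x))},\qquad L_fB(x)\le\alpha_3(h(x)).$$ For $x_0\in\mathbb{R}^n$,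 let $I(x_0)=[t_0,\tau_{\max})$ be the maximal interval of existence of the unique solution $x(t)$ of $\dot x=f(x)$ with $x(t_0)=x_0$. A set $\mathcal{S}$ is (forward) invariant if for every $x_0\in\mathcal{S}$, $x(t)\in\mathcal{S}$ for all $t\in I(x_0)$. *)

(* Defs.v *)
(* R^n is represented by row vectors 'rV[R]_n, over an arbitrary R : realType. *)
From HB Require Import structures.
From mathcomp Require Import all_boot all_order all_algebra.
From mathcomp Require Import all_classical all_reals all_analysis.

Set Implicit Arguments.
Unset Strict Implicit.
Unset Printing Implicit Defensive.

Import Order.TTheory GRing.Theory Num.Theory.
Import numFieldNormedType.Exports.

Local Open Scope classical_set_scope.
Local Open Scope ring_scope.

(* [a, b) with a possibly infinite right endpoint. *)
Definition itv_co (R : realType) (a : R) (b : \bar R) : set R :=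
  [set t | a <= t /\ (t%:E < b)%E].

Definition boundary (T : topologicalType) (A : set T) : set T :=
  closure A `\` interior A.

(* The norm on 'rV[R]_n is the max norm; all norms on R^n being equivalent,
   local Lipschitz continuity does not depend on this choice. *)
Definition locally_lipschitz (R : realType) (n : nat)
    (f : 'rV[R]_n -> 'rV[R]_n) : Prop :=
  forall x : 'rV[R]_n, exists2 U : set 'rV[R]_n, nbhs x U & [lipschitz f y | y in U].

(* A function on an open set U is represented by a total function g whose
   values outside U are irrelevant: differentiability and partial derivatives
   at points of U only depend on g on U. *)
Definition C1_on (R : realType) (n : nat) (U : set 'rV[R]_n)
    (g : 'rV[R]_n -> R) : Prop :=
  forall x, U x -> differentiable g x /\
    forall i : 'I_n,
      {for x, continuous (fun y : 'rV[R]_n => 'D_(delta_mx 0 i) g y)}.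

Definition lie_derivative (R : realType) (n : nat)
    (f : 'rV[R]_n -> 'rV[R]_n) (B : 'rV[R]_n -> R) (x : 'rV[R]_n) : R :=
  'd B x (f x).

(* beta : [0, a) -> [0, +oo[, with a possibly infinite; the values of beta
   outside [0, a) are irrelevant. *)
Definition class_K (R : realType) (a : \bar R) (beta : R -> R) : Prop :=
  [/\ (0 < a)%E,
      {within itv_co 0 a, continuous beta},
      forall s, itv_co 0 a s -> 0 <= beta s,
      forall s t, itv_co 0 a s -> itv_co 0 a t -> s < t -> beta s < beta t
    & beta 0 = 0].

(* The conditions h x < a_i say that h x lies in the domain of alpha_i. *)
Definition reciprocal_barrier (R : realType) (n : nat)
    (f : 'rV[R]_n -> 'rV[R]_n) (h : 'rV[R]_n -> R) (C : set 'rV[R]_n)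
    (B : 'rV[R]_n -> R) : Prop :=
  C1_on (interior C) B /\
  exists (a1 a2 a3 : \bar R) (alpha1 alpha2 alpha3 : R -> R),
    [/\ class_K a1 alpha1, class_K a2 alpha2, class_K a3 alpha3
      & forall x, interior C x ->
        [/\ itv_co 0 a1 (h x), itv_co 0 a2 (h x) & itv_co 0 a3 (h x)] /\
        [/\ 1 / alpha1 (h x) <= B x, B x <= 1 / alpha2 (h x)
          & lie_derivative f B x <= alpha3 (h x)]].

(* x solves x' = f(x), x(t0) = x0 on [t0, tau); the derivative at t0 is the
   right derivative.  The values of x outside [t0, tau) are irrelevant. *)
Definition is_solution (R : realType) (n : nat) (f : 'rV[R]_n -> 'rV[R]_n)
    (t0 : R) (x0 : 'rV[R]_n) (tau : \bar R) (x : R -> 'rV[R]_n) : Prop :=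
  [/\ (t0%:E < tau)%E,
      x t0 = x0,
      s^-1 *: (x (t0 + s) - x t0) @[s --> 0^'+] --> f (x t0)
    & forall t, t0 < t -> (t%:E < tau)%E -> is_derive t 1 x (f (x t))].

(* [t0, tau) is the maximal interval of existence of the solution x: no
   solution extends x to a larger interval. *)
Definition is_maximal_solution (R : realType) (n : nat)
    (f : 'rV[R]_n -> 'rV[R]_n) (t0 : R) (x0 : 'rV[R]_n)
    (tau : \bar R) (x : R -> 'rV[R]_n) : Prop :=
  is_solution f t0 x0 tau x /\
  forall (tau' : \bar R) (y : R -> 'rV[R]_n),
    is_solution f t0 x0 tau' y -> (tau <= tau')%E ->
    (forall t, itv_co t0 tau t -> y t = x t) -> tau' = tau.

(* For locally Lipschitz f, every x0 has exactly one maximal solution (up to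
   the irrelevant values outside the interval), so that the quantification
   over tau and x below ranges over "the" solution and its interval. *)
Definition forward_invariant (R : realType) (n : nat)
    (f : 'rV[R]_n -> 'rV[R]_n) (t0 : R) (S : set 'rV[R]_n) : Prop :=
  forall x0, S x0 ->
  forall (tau : \bar R) (x : R -> 'rV[R]_n),
    is_maximal_solution f t0 x0 tau x ->
    forall t, itv_co t0 tau t -> S (x t).

(* Main.v *)
(* Suppose that a trajectory x issued from Int(C) leaves it, and let T be the
   first time at which h (x t) <= 0.  As t increases to T, h (x t) tends to 0,
   so that alpha3 (h (x t)) < 1 near T: there B (x t) has derivative less than
   1, hence is bounded.  But B (x t) >= 1 / alpha1 (h (x t)) tends to
   infinity, a contradiction. *)
Require Import Defs.
From HB Require Import structures.
From mathcomp Require Import all_boot all_order all_algebra.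
From mathcomp Require Import all_classical all_reals all_analysis.

Set Implicit Arguments.
Unset Strict Implicit.
Unset Printing Implicit Defensive.

Import Order.TTheory GRing.Theory Num.Theory.
Import numFieldNormedType.Exports.

Local Open Scope classical_set_scope.
Local Open Scope ring_scope.

(** Continuity at [0] relative to [[0, a)], together with [beta 0 = 0]. It serves twice: to bound
    [alpha3] by [1] and to push [alpha1] below any prescribed threshold. *)
Lemma class_K_small (R : realType) (a : \bar R) (beta : R -> R) (e : R) :
  class_K a beta -> 0 < e ->
  exists2 d, 0 < d & forall s, itv_co 0 a s -> s < d -> beta s < e.
Proof.
move=> [a0 betac _ _ beta0] e0.
have : beta s @[s --> within (itv_co 0 a) (nbhs 0)] --> beta 0.
  by move/subspace_continuousP: betac; apply; split.
rewrite beta0 => /(@cvgr_lt R)/(_ e e0).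
rewrite near_withinE => /nbhs_ballP[d /= d0 Pd].
exists d => // s as_ sd; apply: Pd => //=.
by rewrite /ball /= sub0r normrN ger0_norm //; case: as_.
Qed.

Lemma class_K_gt0 (R : realType) (a : \bar R) (beta : R -> R) (s : R) :
  class_K a beta -> itv_co 0 a s -> 0 < s -> 0 < beta s.
Proof.
move=> [a0 _ _ betai beta0] as_ s0; rewrite -beta0.
by apply: betai => //; split.
Qed.

(** [T] is the infimum of the times [t >= a] with [phi t <= 0]. Continuity is asked from the right
    only, since a solution has just a right derivative at [t0]. *)
Lemma first_nonpos_time (R : realType) (phi : R -> R) (a b : R) :
  a <= b -> (forall t, a <= t <= b -> phi s @[s --> t^'+] --> phi t) ->
  0 < phi a -> phi b <= 0 ->
  exists T, [/\ a < T, T <= b, phi T <= 0 &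
                forall t, a <= t -> t < T -> 0 < phi t].
Proof.
move=> ab phic phia phib.
pose S := [set t | a <= t /\ phi t <= 0].
have Sb : S b by [].
have lbS : lbound S a by move=> t [].
have S0 : S !=set0 by exists b.
have hlbS : has_lbound S by exists a.
have before t : a <= t -> t < inf S -> 0 < phi t.
  move=> at_; apply: contraTT; rewrite -!leNgt => phit.
  exact: ge_inf.
have aT : a <= inf S by exact: lb_le_inf.
have Tb : inf S <= b by exact: ge_inf.
have phiT : phi (inf S) <= 0.
  (* If [phi] were positive at the infimum, right continuity would keep it positive on
     [[inf S, inf S + d)], an interval that contains a point of [S]. *)
  rewrite leNgt; apply/negP => phiT.
  have /(@cvgr_gt R)/(_ 0 phiT) : phi s @[s --> (inf S)^'+] --> phi (inf S).
    by apply: phic; rewrite aT.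
  rewrite near_withinE => /nbhs_ballP[d /= d0 Pd].
  have [|t [at_ phit] tT] := @inf_lt R S (inf S + d) S0.
    by rewrite ltrDl.
  have := phit; rewrite leNgt => /negP; apply.
  have := ge_inf hlbS (conj at_ phit : S t).
  rewrite le_eqVlt => /predU1P[<- //|Tt].
  apply: Pd => //; rewrite /ball /= distrC gtr0_norm ?subr_gt0//.
  by rewrite ltrBlDl.
exists (inf S); split => //.
rewrite lt_neqAle aT andbT; apply/eqP => aE.
by move: phiT; rewrite -aE leNgt phia.
Qed.

Section solution.
Context (R : realType) (n : nat) (f : 'rV[R]_n -> 'rV[R]_n).
Context (t0 : R) (x0 : 'rV[R]_n) (tau : \bar R) (x : R -> 'rV[R]_n).
Hypothesis x_sol : is_solution f t0 x0 tau x.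

Lemma solution_continuous (t : R) :
  t0 < t -> (t%:E < tau)%E -> {for t, continuous x}.
Proof.
move=> t0t ttau; have [_ _ _ /(_ t t0t ttau) [/derivable1_diffP dx _]] := x_sol.
exact: differentiable_continuous.
Qed.

(** After [t0] this is two-sided continuity. At [t0], the increment of [x] is [s] times a difference
    quotient converging to [f (x t0)], hence it tends to [0]. *)
Lemma solution_right_continuous (t : R) :
  itv_co t0 tau t -> x s @[s --> t^'+] --> x t.
Proof.
move=> [+ ttau]; rewrite le_eqVlt => /predU1P[<-|t0t]; last first.
  exact/cvg_at_right_filter/solution_continuous.
have [_ _ dx _] := x_sol.
have xt0 : x (t0 + s) @[s --> 0^'+] --> x t0.
  have s0 : s @[s --> (0 : R)^'+] --> (0 : R) by exact: cvg_at_right_filter.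
  have : x t0 + s *: (s^-1 *: (x (t0 + s) - x t0)) @[s --> 0^'+] -->
      x t0 + 0 *: f (x t0).
    by apply: cvgD; [exact: cvg_cst|exact: cvgZ].
  rewrite scale0r addr0; apply: cvg_trans; apply: near_eq_cvg.
  near=> s; rewrite /= scalerA mulfV ?scale1r; last first.
    by rewrite gt_eqF//; near: s; exact: nbhs_right_gt.
  by rewrite subrKC.
by move=> A /xt0 ?; apply/nbhs_right0P.
Unshelve. all: by end_near. Qed.

(** Chain rule along the trajectory; it turns the bound on the Lie derivative of [B] into a bound on
    the slope of [B \o x]. *)
Lemma solution_is_derive_comp (g : 'rV[R]_n -> R) (t : R) :
  t0 < t -> (t%:E < tau)%E -> differentiable g (x t) ->
  is_derive t 1 (g \o x) (lie_derivative f g (x t)).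
Proof.
move=> t0t ttau dg.
have [_ _ _ /(_ t t0t ttau) [dx xf]] := x_sol.
have /derivable1_diffP dx' := dx.
have dgx : differentiable (g \o x) t by exact: differentiable_comp.
apply: DeriveDef; first exact/derivable1_diffP.
by rewrite deriveE// diff_comp//= /lie_derivative -xf deriveE.
Qed.

End solution.

Theorem theorem1 (R : realType) (n : nat) (t0 : R)
    (f : 'rV[R]_n -> 'rV[R]_n) (f_lip : locally_lipschitz f)
    (h : 'rV[R]_n -> R) (h_C1 : C1_on [set: 'rV[R]_n] h)
    (C : set 'rV[R]_n)
    (C_def : C = [set x | 0 <= h x])
    (C_boundary : boundary C = [set x | h x = 0])
    (C_interior : interior C = [set x | 0 < h x])
    (C_rbf : exists B : 'rV[R]_n -> R, reciprocal_barrier f h C B) :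
  forward_invariant f t0 (interior C).
Proof.
have [B [B_C1 [a1 [a2 [a3 [al1 [al2 [al3 [K1 _ K3 BP]]]]]]]]] := C_rbf.
rewrite C_interior in B_C1 BP *.
have h_cont y : {for y, continuous h}.
  by apply: differentiable_continuous; have [] := h_C1 y I.
move=> x0 hx0 tau x [x_sol _] t1 [t01 t1tau] /=.
rewrite ltNge; apply/negP => hx1.
have le_t1 t : t <= t1 -> (t%:E < tau)%E.
  by move=> tt1; apply: le_lt_trans t1tau; rewrite lee_fin.
have [||T [t0T Tt1 hT hpos]] := @first_nonpos_time R (h \o x) _ _ t01 _ _ hx1.
- move=> t /andP[t0t tt1].
  apply: (cvg_comp _ _ (solution_right_continuous x_sol _)) (h_cont _).
  by split => //; exact: le_t1.
- by rewrite /=; have [_ -> _ _] := x_sol.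
(* Left continuity of [h \o x] at [T], where its value is at most [0 < e]. *)
have h_small e : 0 < e -> \forall t \near T^'-, h (x t) < e.
  move=> e0.
  have xT : {for T, continuous x}.
    by apply: (solution_continuous x_sol) => //; exact: le_t1.
  have hxT : {for T, continuous (h \o x)} by exact: continuous_comp.
  have : h (x s) @[s --> T^'-] --> h (x T) by exact: cvg_at_left_filter.
  by move=> /(@cvgr_lt R); apply; exact: le_lt_trans e0.
have al_small a al e : class_K a al -> 0 < e ->
    (forall y, 0 < h y -> itv_co 0 a (h y)) ->
    \forall t \near T^'-, al (h (x t)) < e.
  move=> Kal e0 ah; have [d d0 dP] := class_K_small Kal e0.
  near=> t; apply: dP; last by near: t; exact: h_small.
  by apply/ah/hpos; [apply: ltW|]; near: t;
    [exact: nbhs_left_gt|exact: nbhs_left_lt].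
have dom1 y : 0 < h y -> itv_co 0 a1 (h y) by move=> /BP[[]].
have dom3 y : 0 < h y -> itv_co 0 a3 (h y) by move=> /BP[[]].
(* Any [c] in [(T - d, T)] beyond [t0] will do, where [d] is the radius on which the bound on [al3]
   holds to the left of [T]. *)
have : \forall c \near T^'-, [/\ t0 < c, c < T & forall t, c <= t -> t < T ->
    al3 (h (x t)) < 1].
  have := al_small _ _ _ K3 ltr01 dom3.
  rewrite near_withinE => /nbhs_ballP[d /= d0 Pd].
  near=> c; split; [by near: c; exact: nbhs_left_gt| |].
    by near: c; exact: nbhs_left_lt.
  move=> t ct tT; apply: Pd => //; rewrite /ball /= gtr0_norm ?subr_gt0//.
  rewrite ltrBlDr -ltrBlDl; apply: lt_le_trans ct.
  by near: c; apply: nbhs_left_gt; rewrite ltrBlDr ltrDl.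
case/filter_ex => c [t0c cT cP].
(* [M] bounds [B \o x] on [[c, T)]: the initial value plus a slope below [1] over a length less than
   [T - c]. The absolute value makes [M] positive, so that [M^-1] is an admissible threshold for
   [al1]. *)
set M := `|B (x c)| + (T - c).
have M0 : 0 < M by rewrite ltr_wpDl// subr_gt0.
have [t [ct tT al1t]] : exists t, [/\ c < t, t < T & al1 (h (x t)) < M^-1].
  apply: (@filter_ex _ T^'-); near=> t; split.
  - by near: t; exact: nbhs_left_gt.
  - by near: t; exact: nbhs_left_lt.
  - by near: t; apply: (al_small _ _ _ K1); rewrite ?invr_gt0.
have hx s : c <= s -> s < T -> 0 < h (x s).
  by move=> cs; apply: hpos; exact: le_trans (ltW t0c) cs.
have dBx s : c <= s -> s < T ->
    is_derive s 1 (B \o x) (lie_derivative f B (x s)).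
  move=> cs sT; apply: (solution_is_derive_comp x_sol).
  - exact: lt_le_trans cs.
  - by apply: le_t1; exact: le_trans (ltW sT) Tt1.
  - by have [] := B_C1 _ (hx s cs sT).
(* On [[c, t]] with [t < T] the trajectory stays where [h > 0], so [B \o x] is differentiable
   there. *)
have [||s] := @MVT R (B \o x) (fun s => lie_derivative f B (x s)) c t ct.
- move=> s; rewrite in_itv/= => /andP[cs st].
  by apply: dBx; [exact: ltW|exact: lt_trans tT].
- apply: derivable_within_continuous => s; rewrite in_itv/= => /andP[cs st].
  by have [] := dBx s cs (le_lt_trans st tT).
rewrite in_itv/= => /andP[cs st] Bts.
have sT := lt_trans st tT.
have [_ [_ _ LB]] := BP _ (hx s (ltW cs) sT).
have hxt := hx t (ltW ct) tT.
have [[d1 _ _] [B1 _ _]] := BP _ hxt.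
have LB1 : lie_derivative f B (x s) < 1.
  by apply: le_lt_trans LB _; apply: cP => //; exact: ltW.
have BtM : B (x t) <= M.
  rewrite -(subrK (B (x c)) (B (x t))) Bts addrC lerD ?ler_norm//.
  rewrite (@le_trans _ _ (t - c))//; last by rewrite lerD2r ltW.
  by apply: ler_piMl; rewrite ?subr_ge0 ltW.
(* The lower barrier bound gives [1 / al1 (h (x t)) <= B (x t) <= M]; inverting these positive
   numbers contradicts the choice of [t]. *)
move: al1t; rewrite ltNge => /negP; apply.
have al1_gt0 := class_K_gt0 K1 d1 hxt.
rewrite -(invrK (al1 _)) lef_pV2 ?posrE ?invr_gt0//.
by apply: le_trans BtM; rewrite -div1r.
Unshelve. all: by end_near. Qed.
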